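(* Let $\alpha>0$, $\beta>0$, let $n\ge0$ be an integer and $t>0$. Let $D_n(t)=\det\left(\int_0^1 x^{i+j}w(x;t)\,dx\right)_{i,j=0}^{n-1}$ with $w(x;t)=e^{-t/x}x^\alpha(1-x)^\beta$, and $H_n(t):=t\frac{d}{dt}\ln D_n(t)$. Then $$r_n^*=\frac{nt+tH_n'}{2n+\alpha+\beta},\qquad r_n=\frac{n(n+\alpha)+tH_n'-H_n}{2n+\alpha+\beta},$$ where $r_n,r_n^*$ are defined in the context and $'$ denotes $d/dt$.
   Context: $P_n$ is the monic polynomial of degree $n$ with $\int_0^1P_mP_nw\,dx=h_n\delta_{m,n}$. $r_n^*:=\frac{t}{h_{n-1}}\int_0^1P_{n-1}(y)P_n(y)w(y;t)\frac{dy}{y}$, $r_n:=\frac{\beta}{h_{n-1}}\int_0^1P_{n-1}(y)P_n(y)w(y;t)\frac{dy}{1-y}$, with $r_0=r_0^*:=0$; $D_0:=1$. *)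

(* Defs.v *)
From HB Require Import structures.
From mathcomp Require Import all_boot all_order all_algebra.
From mathcomp Require Import all_classical all_reals all_analysis.

Set Implicit Arguments.
Unset Strict Implicit.
Unset Printing Implicit Defensive.

Import Order.TTheory GRing.Theory Num.Theory.
Import numFieldNormedType.Exports.

Local Open Scope classical_set_scope.
Local Open Scope ring_scope.

(* Lebesgue integral, so that the endpoint singularity of (1 - y)^(beta - 1)
   in r_n is covered when beta < 1. *)
Definition int01 (R : realType) (f : R -> R) : R :=
  \int[@lebesgue_measure R]_(x in `[0, 1]) f x.

(* At x = 0 the convention 0^-1 = 0 gives 1 * 0 `^ a = 0 for a > 0, which is
   the limit of the weight at 0+ when t > 0. *)
Definition weight (R : realType) (a b : R) (x t : R) : R :=
  expR (- t / x) * x `^ a * (1 - x) `^ b.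

Definition hankel_det (R : realType) (a b : R) (n : nat) (t : R) : R :=
  \det (\matrix_(i < n, j < n) int01 (fun x => x ^+ (i + j) * weight a b x t)).

Definition H_ (R : realType) (a b : R) (n : nat) (t : R) : R :=
  t * derive1 (fun s => ln (hankel_det a b n s)) t.

Definition monic_orthogonal (R : realType) (a b t : R)
    (P : nat -> {poly R}) (h : nat -> R) : Prop :=
  (forall n, P n \is monic /\ size (P n) = n.+1) /\
  (forall m n, int01 (fun x => (P m).[x] * (P n).[x] * weight a b x t)
               = h n * (m == n)%:R).

Definition rstar (R : realType) (a b t : R)
    (P : nat -> {poly R}) (h : nat -> R) (n : nat) : R :=
  if n is k.+1 then
    t / h k * int01 (fun y => (P k).[y] * (P k.+1).[y] * weight a b y t / y)
  else 0.

Definition r_ (R : realType) (a b t : R)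
    (P : nat -> {poly R}) (h : nat -> R) (n : nat) : R :=
  if n is k.+1 then
    b / h k *
      int01 (fun y => (P k).[y] * (P k.+1).[y] * weight a b y t / (1 - y))
  else 0.

(* Main.v *)
(* Write L_s q and M_s q for the integrals over [0, 1] of q w(.; s) and
   q w(.; s) / x, V_n(s) for the monic orthogonal polynomials of L_s, h_n(s) for
   their norms, and p_n(s) for the coefficient of X^(n-1) in V_n(s).  As
   dL_s/ds = - M_s, and dV_n/ds has degree < n, h_n' = - M_s (V_n^2); hence
   D_n = h_0 ... h_(n-1) gives H_n = - s sum_(j < n) M_s (V_j^2) / h_j.
   Integrating the derivative of x (1 - x) V_j^2 w evaluates s M_s (V_j^2) / h_j
   in terms of p_j and p_(j+1), and the sum telescopes to
     H_n = (2n + a + b) p_n - n s + n (n + a).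
   Differentiating L_s (V_n V_(n-1)) = 0 gives s p_n' = rstar_n, whence the first
   formula without any second derivative of D_n.  Integrating the derivative of
   x V_n V_(n-1) w gives r_n = rstar_n - p_n, whence the second. *)
Require Import Defs.
From HB Require Import structures.
From mathcomp Require Import all_boot all_order all_algebra.
From mathcomp Require Import all_classical all_reals all_analysis.
From mathcomp Require Import measurable_realfun lebesgue_integral_under ring lra.
Set Implicit Arguments.
Unset Strict Implicit.
Unset Printing Implicit Defensive.
Import Order.TTheory GRing.Theory Num.Theory.
Import numFieldNormedType.Exports.
Local Open Scope classical_set_scope.
Local Open Scope ring_scope.

(** * The weight *)

Section Weight.
Context (R : realType).
Implicit Types (a b t x : R) (q : {poly R}).
Notation mu := (@lebesgue_measure R).

Lemma weight_ge0 a b x t : 0 <= weight a b x t.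
Proof. by rewrite /weight !mulr_ge0 ?expR_ge0 ?powR_ge0. Qed.

Lemma weight_gt0 a b x t : 0 < x < 1 -> 0 < weight a b x t.
Proof.
move=> /andP[x0 x1].
by rewrite /weight !mulr_gt0 ?expR_gt0 ?powR_gt0 ?subr_gt0.
Qed.

Lemma powR_le1 x p : 0 <= x <= 1 -> 0 < p -> x `^ p <= 1.
Proof.
move=> /andP[x0 x1] p0.
by rewrite -[leRHS](congr1 (fun f => f p) (powR1 R)) ge0_ler_powR ?nnegrE ?(ltW p0).
Qed.

(** Equivalent for x > 0 to t / x <= exp (t / x), a consequence of 1 + y <= exp y; at x = 0 the left
    side is 0 by the convention 0^-1 = 0. Hence w / x stays bounded on [0, 1]. *)
Lemma expRNV_div_le x t : 0 <= x -> 0 < t -> expR (- t / x) / x <= t^-1.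
Proof.
rewrite le_eqVlt => /predU1P[<- t0|x0 t0].
  by rewrite invr0 mulr0 invr_ge0 ltW.
rewrite mulNr expRN -invfM lef_pV2 ?posrE ?mulr_gt0 ?expR_gt0//.
rewrite -ler_pdivrMr//.
by apply: le_trans (expR_ge1Dx _); rewrite lerDr.
Qed.

Lemma weight_le1 a b x t : 0 < a -> 0 < b -> 0 <= t -> 0 <= x <= 1 ->
  weight a b x t <= 1.
Proof.
move=> a0 b0 t0 x01; have /andP[x0 x1] := x01.
rewrite /weight !mulr_ile1 ?mulr_ge0 ?expR_ge0 ?powR_ge0 ?powR_le1 ?subr_ge0//
  ?lerBlDr ?lerDl//.
by rewrite -expR0 ler_expR mulNr oppr_le0 divr_ge0.
by rewrite x1 x0.
Qed.

Lemma weightV_le a b x t : 0 < a -> 0 < b -> 0 < t -> 0 <= x <= 1 ->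
  weight a b x t / x <= t^-1.
Proof.
move=> a0 b0 t0 x01; have /andP[x0 x1] := x01.
have -> : weight a b x t / x = (expR (- t / x) / x) * (x `^ a * (1 - x) `^ b).
  by rewrite /weight; ring.
rewrite -[leRHS]mulr1 ler_pM ?mulr_ge0 ?expR_ge0 ?powR_ge0 ?invr_ge0 ?expRNV_div_le//.
by rewrite mulr_ile1 ?powR_ge0 ?powR_le1// subr_ge0 x1 lerBlDr lerDl.
Qed.

(** On nonnegative reals the inverse is the power of exponent -1, also at 0, where both are 0 by
    convention. *)
Lemma measurable_inv01 : measurable_fun `[(0 : R), (1 : R)] (@GRing.inv R).
Proof.
apply: (eq_measurable_fun (fun x : R => x `^ (-1))).
  by move=> x /[!inE]/=; rewrite in_itv/= => /andP[x0 _]; rewrite powR_inv1.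
apply: measurable_funTS; exact: measurable_powR.
Qed.

Lemma measurable_onem_inv01 :
  measurable_fun `[(0 : R), (1 : R)] (fun x : R => (1 - x)^-1).
Proof.
apply: (eq_measurable_fun (fun x : R => (1 - x) `^ (-1))).
  by move=> x /[!inE]/=; rewrite in_itv/= => /andP[_ x0]; rewrite powR_inv1 ?subr_ge0.
apply: measurable_funTS; apply: (measurableT_comp (measurable_powR _)).
exact: measurable_funB.
Qed.

Lemma measurable_weight a b t :
  measurable_fun `[(0 : R), (1 : R)] (fun x => weight a b x t).
Proof.
apply: measurable_funM; first apply: measurable_funM.
- apply: measurableT_comp => //; apply: measurable_funM => //.
  exact: measurable_inv01.
- apply: measurable_funTS; exact: measurable_powR.
- apply: measurable_funTS; apply: (measurableT_comp (measurable_powR _)).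
  exact: measurable_funB.
Qed.

Lemma measurable_horner (D : set R) q : measurable D ->
  measurable_fun D (fun x => q.[x]).
Proof.
move=> mD; apply: measurable_funTS; apply: continuous_measurable_fun.
exact: continuous_horner.
Qed.

Lemma horner01_bound q : exists2 C : R, 0 <= C &
  forall x, 0 <= x <= 1 -> `|q.[x]| <= C.
Proof.
exists (\sum_(i < size q) `|q`_i|); first exact: sumr_ge0.
move=> x /andP[x0 x1]; rewrite horner_coef; apply: le_trans (ler_norm_sum _ _ _) _.
apply: ler_sum => i _; rewrite normrM ler_piMr// normrX exprn_ile1//.
by rewrite ger0_norm.
Qed.

Lemma bounded_integrable01 (f : R -> R) C : measurable_fun `[(0 : R), (1 : R)] f ->
  (forall x, 0 <= x <= 1 -> `|f x| <= C) -> mu.-integrable `[0, 1] (EFin \o f).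
Proof.
move=> mf fC; apply: measurable_bounded_integrable => //.
  by rewrite /= lebesgue_measure_itv/= lte_fin ltr01 -EFinB ltry.
exists C; split; first exact: num_real.
by move=> M CM x /=; rewrite in_itv/= => x01; rewrite (le_trans (fC _ x01))// ltW.
Qed.

Lemma integrable_weight a b t q : 0 < a -> 0 < b -> 0 < t ->
  mu.-integrable `[0, 1] (EFin \o (fun x => q.[x] * weight a b x t)).
Proof.
move=> a0 b0 t0; have [C C0 qC] := horner01_bound q.
apply: (bounded_integrable01 (C := C)).
  by apply: measurable_funM; [exact: measurable_horner|exact: measurable_weight].
move=> x x01; rewrite normrM -[leRHS]mulr1 ler_pM ?qC//.
by rewrite ger0_norm ?weight_ge0 ?weight_le1 ?(ltW t0).
Qed.

Lemma integrable_weightV a b t q : 0 < a -> 0 < b -> 0 < t ->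
  mu.-integrable `[0, 1] (EFin \o (fun x => q.[x] * weight a b x t / x)).
Proof.
move=> a0 b0 t0; have [C C0 qC] := horner01_bound q.
apply: (bounded_integrable01 (C := C * t^-1)).
  apply: measurable_funM; last exact: measurable_inv01.
  by apply: measurable_funM; [exact: measurable_horner|exact: measurable_weight].
move=> x x01; rewrite -mulrA normrM ler_pM ?qC//.
by rewrite ger0_norm ?weightV_le// mulr_ge0 ?weight_ge0// invr_ge0; case/andP: x01.
Qed.

End Weight.

(** * Integrals of polynomials against the weight *)

(** Induction on the size, splitting off one linear factor at a time. It makes the zero set of a
    nonzero polynomial negligible, for the positivity of the norms. *)
Lemma finite_root (R : idomainType) (q : {poly R}) :
  q != 0 -> finite_set [set x | root q x].
Proof.
have [n] := ubnP (size q); elim: n q => // n IHn q sq q0.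
have [[x qx]|nr] := pselect (exists x, root q x); last first.
  rewrite (_ : [set _ | _] = set0) // -subset0 => x /= qx.
  by apply: nr; exists x.
have /factor_theorem[p qE] := qx.
have p0 : p != 0 by apply: contraNneq q0 => p0; rewrite qE p0 mul0r.
rewrite (_ : [set _ | _] = [set y | root p y] `|` [set x]).
  rewrite finite_setU; split => //; apply: IHn => //.
  by move: sq; rewrite qE size_Mmonic ?monicXsubC// size_XsubC addn2/= ltnS.
apply/seteqP; split => y; rewrite /= qE rootM root_XsubC.
  by move=> /orP[|/eqP]; [left|right].
by case=> [->//|->]; rewrite eqxx orbT.
Qed.

(** The functional L_t, kept as a function on polynomials so that orthogonality can be treated
    algebraically. *)
Definition wint (R : realType) (a b t : R) (q : {poly R}) : R :=
  int01 (fun x => q.[x] * weight a b x t).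

(** The functional M_t, which is minus the derivative of L_t in t. *)
Definition wintV (R : realType) (a b t : R) (q : {poly R}) : R :=
  int01 (fun x => q.[x] * weight a b x t / x).

Section WeightedIntegrals.
Context (R : realType) (a b : R) (a0 : 0 < a) (b0 : 0 < b).
Implicit Types (t x : R) (q : {poly R}).
Notation mu := (@lebesgue_measure R).

Lemma wint_scalar t : 0 < t -> scalar (wint a b t).
Proof.
move=> t0 k u v; rewrite /wint /int01 -RintegralZl//; last exact: integrable_weight.
rewrite -RintegralD//; last 2 first.
- apply: eq_integrable (integrable_weight (k *: u) a0 b0 t0) => // x _.
  rewrite /= hornerZ; congr (_%:E); ring.
- exact: integrable_weight.
by apply: eq_Rintegral => x _; rewrite hornerD hornerZ; ring.
Qed.

Lemma wintV_scalar t : 0 < t -> scalar (wintV a b t).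
Proof.
move=> t0 k u v; rewrite /wintV /int01 -RintegralZl//; last exact: integrable_weightV.
rewrite -RintegralD//; last 2 first.
- apply: eq_integrable (integrable_weightV (k *: u) a0 b0 t0) => // x _.
  rewrite /= hornerZ; congr (_%:E); ring.
- exact: integrable_weightV.
by apply: eq_Rintegral => x _; rewrite hornerD hornerZ; ring.
Qed.

Lemma wintVMX t q : wintV a b t ('X * q) = wint a b t q.
Proof.
apply: eq_Rintegral => x _; rewrite hornerM hornerX.
have [->|x0] := eqVneq x 0; last by field.
by rewrite /weight powR0 ?gt_eqF// !(mul0r, mulr0).
Qed.

Lemma is_derive_weight x t :
  is_derive t 1 (weight a b x) (- (weight a b x t / x)).
Proof.
rewrite [X in is_derive _ _ X _](_ : _ =
  (fun s => expR (s * (- x^-1)) * (x `^ a * (1 - x) `^ b))); last first.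
  by apply/funext => s; rewrite /weight -mulrA mulrN mulNr.
apply: is_derive_eq.
by rewrite /GRing.scale/= /weight mulrN -mulNr; ring.
Qed.

(** Differentiation under the integral sign, with a constant as dominating function: C bounds q on
    [0, 1], and w / x <= 1 / s. *)
Lemma is_derive_wint t q : 0 < t ->
  is_derive t 1 (fun s => wint a b s q) (- wintV a b t q).
Proof.
move=> t0; have [C C0 qC] := horner01_bound q.
pose f s x := q.[x] * weight a b x s.
have df (s x : R) : is_derive s 1 (f ^~ x) (- (q.[x] * weight a b x s / x)).
  have := is_derive_weight x s => ?; apply: is_derive_eq.
  by rewrite /GRing.scale/= /cst; ring.
have p1 (s x : R) : partial1of2 f s x = - (q.[x] * weight a b x s / x).
  by rewrite /partial1of2 derive1E; apply: derive_val.
(* The left end t / 2 keeps s away from 0, so that 1 / s <= (t / 2)^-1 uniformly. *)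
have Ia : `]t / 2, t + 1[%classic t by rewrite /= in_itv/=; lra.
have I0 s : `]t / 2, t + 1[%classic s -> 0 < s by rewrite /= in_itv/=; lra.
have intf s : `]t / 2, t + 1[%classic s ->
    mu.-integrable `[0, 1] (EFin \o f s).
  by move=> /I0 s0; exact: integrable_weight.
have derf s x : `]t / 2, t + 1[%classic s -> `[(0 : R), 1]%classic x ->
    derivable (f ^~ x) s 1 by move=> _ _; apply: ex_derive.
have G0 : forall x : R, 0 <= cst (C * (t / 2)^-1) x.
  by move=> x; rewrite mulr_ge0// invr_ge0 divr_ge0// ltW.
have intG : mu.-integrable `[0, 1] (EFin \o cst (C * (t / 2)^-1)).
  apply: (@bounded_integrable01 _ _ (C * (t / 2)^-1)) => // x _.
  by rewrite ger0_norm// mulr_ge0// invr_ge0 divr_ge0// ltW.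
have G_ub (s x : R) : `]t / 2, t + 1[%classic s -> `[(0 : R), 1]%classic x ->
    `|partial1of2 f s x| <= cst (C * (t / 2)^-1) x.
  rewrite p1 /= => Is; have s0 := I0 _ Is; move: Is; rewrite !in_itv/= => Is x01.
  rewrite normrN -mulrA normrM ler_pM ?qC//.
  rewrite ger0_norm; last by rewrite divr_ge0 ?weight_ge0//; case/andP: x01.
  apply: le_trans (weightV_le a0 b0 s0 x01) _.
  by rewrite lef_pV2 ?posrE ?divr_gt0//; lra.
have := @derivable_under_integral R _ _ mu f _ (measurable_itv `[(0 : R), 1])
  t (t / 2) (t + 1) Ia intf derf _ G0 intG G_ub.
have := @differentiation_under_integral R _ _ mu f _ (measurable_itv `[(0 : R), 1])
  t (t / 2) (t + 1) Ia intf derf _ G0 intG G_ub.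
rewrite derive1E => Fd Fx; apply: DeriveDef => //.
rewrite [LHS]Fd -[RHS]mulN1r -RintegralZl//; last exact: integrable_weightV.
by apply: eq_Rintegral => x _; rewrite p1 mulN1r.
Qed.

(** A nonnegative function with integral 0 vanishes almost everywhere. As w > 0 inside the interval,
    q would then vanish almost everywhere there, although it has finitely many roots. *)
Lemma wint_sqr_gt0 t q : 0 < t -> q != 0 -> 0 < wint a b t (q * q).
Proof.
move=> t0 q0; rewrite lt_neqAle; apply/andP; split; last first.
  by apply: Rintegral_ge0 => x _; rewrite hornerM mulr_ge0 ?weight_ge0// -expr2 sqr_ge0.
apply/eqP => /esym L0.
pose f := fun x => (q * q).[x] * weight a b x t.
have f_ge0 x : 0 <= f x.
  by rewrite /f hornerM mulr_ge0 ?weight_ge0// -expr2 sqr_ge0.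
have intf := integrable_weight (q * q) a0 b0 t0.
have mf : measurable_fun `[(0 : R), 1] (EFin \o f) by exact: measurable_int intf.
have : (\int[mu]_(x in `[(0%R : R), 1%R]) `|(EFin \o f) x| = 0)%E.
  transitivity ((wint a b t (q * q))%:E); last by rewrite L0.
  rewrite /wint /int01 /Rintegral fineK; last exact: integrable_fin_num.
  by apply: eq_integral => x _; rewrite /= ger0_norm.
move=> /(ae_eq_integral_abs mu (measurable_itv _) mf) [N [mN N0 sN]].
have r0 : mu [set x | root q x] = 0%E.
  by apply: countable_lebesgue_measure0; apply/finite_set_countable/finite_root.
have mr : measurable [set x : R | root q x].
  by apply: countable_measurable => //; apply/finite_set_countable/finite_root.
(* Each point of ]0, 1[ is a root of q or lies in the null set N, which contradicts the length 1. *)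
have : mu `](0 : R), 1[%classic = 0%E.
  apply: (@subset_measure0 _ _ _ mu _ (N `|` [set x | root q x])) => //.
  - exact: measurableU.
  - move=> x x01; have [qx|qx] := boolP (root q x); [by right|left].
    apply: sN => /= H.
    have /H/eqP : `[(0 : R), 1]%classic x by apply: subset_itv_oo_cc.
    move: x01; rewrite /= in_itv/= => x01.
    rewrite eqe gt_eqF//.
    rewrite /f hornerM mulr_gt0 ?weight_gt0//.
    by rewrite -expr2 lt_neqAle sqr_ge0 eq_sym sqrf_eq0 andbT.
  - apply/eqP; rewrite -measure_le0; apply: le_trans (measureU2 _ _ _) _ => //.
    rewrite -[leRHS]adde0; apply: leeD.
      by move: N0 => /= ->.
    by move: r0 => /= ->.
by move/eqP; rewrite lebesgue_measure_itv/= lte_fin ltr01 -EFinB eqe subr0 oner_eq0.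
Qed.
End WeightedIntegrals.

(** * Integration by parts up to the endpoints *)

Section ImproperFTC.
Context (R : realType).
Notation mu := (@lebesgue_measure R).

(** The integrand may be unbounded at the ends. The classical theorem on inner segments shows that F
    differs by a constant from the indefinite integral G; both are continuous on [a, b], so the
    constant persists at the ends. *)
Lemma FTC2_integrable (f F : R -> R) (a b : R) : a < b ->
  mu.-integrable `[a, b] (EFin \o f) ->
  {in `]a, b[, continuous f} ->
  {in `]a, b[, forall x : R, is_derive x 1 F (f x)} ->
  {within `[a, b], continuous F} ->
  \int[mu]_(x in `[a, b]) f x = F b - F a.
Proof.
move=> ab intf cf dF cF.
pose G x := \int[mu]_(t in `[a, x]) f t.
have cG : {within `[a, b], continuous G}.
  exact: (parameterized_integral_continuous (ltW ab) intf).
have GFlt x y : x \in `]a, b[ -> y \in `]a, b[ -> x < y -> G y - G x = F y - F x.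
  move=> xab yab xy.
  have [ax xb] : a < x /\ x < b by move: xab; rewrite in_itv/= => /andP[].
  have [ay yb] : a < y /\ y < b by move: yab; rewrite in_itv/= => /andP[].
  have sub z : z \in `[x, y] -> z \in `]a, b[.
    rewrite !in_itv/= => /andP[xz zy].
    by rewrite (lt_le_trans ax xz) (le_lt_trans zy yb).
  have dFz z : z \in `[x, y] -> derivable F z 1.
    by move=> /sub/dF Fz; apply: ex_derive.
  have intay : mu.-integrable `[a, y] (EFin \o f).
    by apply: integrableS intf => //; apply: subset_itvl; rewrite bnd_simp; exact: ltW.
  rewrite /G Rintegral_itvB ?bnd_simp ?(ltW ax) ?(ltW xy)//.
  rewrite Rintegral_itv_obnd_cbnd; last first.
    apply: integrableS intf => //; apply: subset_itv; rewrite bnd_simp; exact: ltW.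
  rewrite /Rintegral (@continuous_FTC2 _ f F)//.
  - by apply: continuous_in_subspaceT => z /[!inE] zxy; apply/cf/sub.
  - have /(continuous_within_itvP _ xy)[_ Fx Fy] := derivable_within_continuous dFz.
    split => // z zxy; apply: dFz; exact: subset_itv_oo_cc zxy.
  - move=> z zxy; have /dF Fz : z \in `]a, b[ by apply/sub/subset_itv_oo_cc.
    by rewrite derive1E; apply: derive_val.
pose c := (a + b) / 2.
have cab : c \in `]a, b[ by rewrite in_itv/= !midf_lt.
have GF : {in `]a, b[, forall x, G x - F x = G c - F c}.
  move=> x xab; have [xc|xc|->//] := ltgtP x c.
    by have := GFlt _ _ xab cab xc; lra.
  by have := GFlt _ _ cab xab xc; lra.
have /(continuous_within_itvP _ ab)[_ Ga Gb] := cG.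
have /(continuous_within_itvP _ ab)[_ Fa Fb] := cF.
have GFa : G a - F a = G c - F c.
  apply: (@cvg_unique _ _ ((G \- F) x @[x --> a^'+])) => //; first exact: cvgB.
  apply: cvg_near_cst; near=> x; apply: GF.
  by rewrite in_itv/=; apply/andP; split.
have GFb : G b - F b = G c - F c.
  apply: (@cvg_unique _ _ ((G \- F) x @[x --> b^'-])) => //; first exact: cvgB.
  apply: cvg_near_cst; near=> x; apply: GF.
  by rewrite in_itv/=; apply/andP; split.
have Ga0 : G a = 0 by rewrite /G set_itv1 Rintegral_set1.
by rewrite -/(G b); lra.
Unshelve. all: by end_near. Qed.

Lemma is_derive_onem_powR (b x : R) : x < 1 ->
  is_derive x 1 (fun y : R => (1 - y) `^ b) (- (b * (1 - x) `^ (b - 1))).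
Proof.
move=> x1; have x0 : 0 < 1 - x by rewrite subr_gt0.
have d1 : is_derive x 1 (fun y : R => 1 - y) (-1).
  by apply: is_derive_eq; ring.
have d2 := @is_derive1_comp R (@powR R ^~ b) (fun y => 1 - y) x _ _
  (is_derive1_powR b x0) d1.
by apply: is_derive_eq d2 _; ring.
Qed.

(** The antiderivative - (1 - x)^b / b bounds the integral over [0, c] by 1 / b for every c < 1;
    monotone convergence along c = 1 - 1 / (n + 1) gives the bound on [0, 1[. *)
Lemma integrable_onem_powR (b : R) : 0 < b ->
  mu.-integrable `[0, 1] (EFin \o (fun x : R => (1 - x) `^ (b - 1))).
Proof.
move=> b0; pose g (x : R) := (1 - x) `^ (b - 1).
have mg (D : set R) : measurable D -> measurable_fun D (EFin \o g).
  move=> mD; apply/measurable_EFinP.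
  apply: measurable_funTS; apply: (measurableT_comp (measurable_powR _)).
  exact: measurable_funB.
have intg c : 0 <= c < 1 -> (\int[mu]_(x in `[(0:R)%R, c]) (g x)%:E <= (b^-1)%:E)%E.
  (* The degenerate case c = 0 does occur: it is the first segment of the exhaustion, at n = 0. *)
  move=> /andP[]; rewrite le_eqVlt => /predU1P[<- _|c0 c1].
    by rewrite set_itv1 integral_set1 lee_fin invr_ge0 ltW.
  pose F (x : R) := - b^-1 * (1 - x) `^ b.
  have dF (x : R) : x < 1 -> is_derive x 1 F (g x).
    move=> /(is_derive_onem_powR b) ?; apply: is_derive_eq.
    by rewrite /GRing.scale/= /g; field; rewrite gt_eqF.
  have dg (x : R) : x < 1 -> derivable g x 1.
    by move=> /(is_derive_onem_powR (b - 1)) ?; apply: ex_derive.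
  have lt1 x : x \in `[0, c] -> x < 1.
    by rewrite in_itv/= => /andP[_ xc]; exact: le_lt_trans xc c1.
  rewrite (@continuous_FTC2 _ g F)//.
  - rewrite -EFinB lee_fin /F subr0 powR1 mulr1 opprK mulNr addrC lerBlDr lerDl.
    by rewrite mulr_ge0 ?invr_ge0 ?(ltW b0) ?powR_ge0.
  - by apply: derivable_within_continuous => x /lt1; exact: dg.
  - have dF' x : x \in `[0, c] -> derivable F x 1.
      by move=> /lt1/dF Fx; apply: ex_derive.
    have /(continuous_within_itvP _ c0)[_ F0 Fc] := derivable_within_continuous dF'.
    by split => // x x0c; apply: dF'; exact: subset_itv_oo_cc x0c.
  - move=> x x0c; have /lt1/dF Fx : x \in `[0, c] by exact: subset_itv_oo_cc x0c.
    by rewrite derive1E; apply: derive_val.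
have eE : `[(0 : R), 1[%classic = \bigcup_n `[(0 : R), 1 - n.+1%:R^-1]%classic.
  exact: itv_bnd_open_bigcup.
apply/integrableP; split; first exact: mg.
rewrite -integral_itv_bndo_bndc; last first.
  by apply: measurableT_comp => //; exact: mg.
under eq_integral => x _ do rewrite /= ger0_norm ?powR_ge0//.
apply: (@le_lt_trans _ _ (b^-1)%:E); last exact: ltry.
rewrite eE.
have H : (\int[mu]_(x in `[(0 : R)%R, (1 - n.+1%:R^-1)%R]) (g x)%:E @[n --> \oo] -->
    \int[mu]_(x in \bigcup_n `[(0 : R)%R, (1 - n.+1%:R^-1)%R]%classic) (g x)%:E)%E.
  apply: ge0_nondecreasing_set_cvg_integral => //.
  - apply/nondecreasing_seqP => n; rewrite subsetEset; apply: subset_itvl.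
    by rewrite bnd_simp lerD2l lerN2 lef_pV2 ?posrE// ler_nat.
  - by move=> n; exact: mg.
  - by move=> n x _; rewrite lee_fin powR_ge0.
rewrite -(cvg_lim _ H)//; apply: lime_le; first by apply/cvg_ex; eexists; exact: H.
apply: nearW => n; apply: intg.
by rewrite subr_ge0 invf_le1// ler1n/= gtrBl invr_gt0.
Qed.
End ImproperFTC.

(** * Integration by parts against the weight *)

Definition wint1V (R : realType) (a b t : R) (q : {poly R}) : R :=
  int01 (fun x => q.[x] * weight a b x t / (1 - x)).

Section IntegrationByParts.
Context (R : realType) (a b : R) (a0 : 0 < a) (b0 : 0 < b).
Implicit Types (t x : R) (q : {poly R}).
Notation mu := (@lebesgue_measure R).

Lemma is_derive_weight_x t x : 0 < x < 1 ->
  is_derive x 1 (fun y => weight a b y t)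
    (weight a b x t * (t / x ^+ 2 + a / x - b / (1 - x))).
Proof.
move=> /andP[x0 x1].
have dE : is_derive x 1 (fun y : R => expR (- t / y)) (expR (- t / x) * (t / x ^+ 2)).
  have dV : is_derive x 1 (fun y : R => - t / y) (t / x ^+ 2).
    have x_neq0 : (fun y : R => y) x != 0 by rewrite gt_eqF.
    have := is_deriveV x_neq0 (is_derive_id x 1) => ?.
    apply: is_derive_eq; rewrite /GRing.scale/=; field; exact/lt0r_neq0.
  exact: (@is_derive1_comp R expR (fun y => - t / y)).
have dA := is_derive1_powR a x0.
have dB := is_derive_onem_powR b x1.
apply: is_derive_eq (is_deriveM (is_deriveM dE dA) dB) _; rewrite !fctE /weight /GRing.scale/=.
(* With each power lowered by one, the claim is a rational identity in x. *)
have -> : x `^ a = x * x `^ (a - 1) by rewrite mulr_powRB1// ltW.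
have -> : (1 - x) `^ b = (1 - x) * (1 - x) `^ (b - 1).
  by rewrite mulr_powRB1// subr_ge0 ltW.
by field; rewrite !gt_eqF ?subr_gt0.
Qed.

(** The other two factors of the weight are at most 1; at x = 1 the left side is 0 by convention.
    The right side is the integrable majorant for the integrals with 1 / (1 - x). *)
Lemma weight1V_le t x : 0 < t -> 0 <= x <= 1 ->
  weight a b x t / (1 - x) <= (1 - x) `^ (b - 1).
Proof.
move=> t0 x01; have /andP[x0] := x01; rewrite le_eqVlt => /predU1P[->|x1].
  by rewrite subrr invr0 mulr0 powR_ge0.
rewrite ler_pdivrMr ?subr_gt0// [leRHS]mulrC mulr_powRB1 ?subr_ge0 ?(ltW x1)//.
rewrite /weight ler_piMl ?powR_ge0// mulr_ile1 ?expR_ge0 ?powR_ge0 ?powR_le1//.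
by rewrite -expR0 ler_expR mulNr oppr_le0 divr_ge0// ltW.
Qed.

Lemma integrable_weight1V t q : 0 < t ->
  mu.-integrable `[0, 1] (EFin \o (fun x => q.[x] * weight a b x t / (1 - x))).
Proof.
move=> t0; have [C C0 qC] := horner01_bound q.
have intC : mu.-integrable `[0, 1] (EFin \o (fun x : R => C * (1 - x) `^ (b - 1))).
  apply: eq_integrable (integrableZl _ C (integrable_onem_powR b0)) => //.
apply: le_integrable intC => //.
  apply/measurable_EFinP/measurable_funM; last exact: measurable_onem_inv01.
  by apply: measurable_funM; [exact: measurable_horner|exact: measurable_weight].
move=> x; rewrite /= in_itv/= => x01; rewrite lee_fin -mulrA normrM.
rewrite [leRHS]normrM (ger0_norm C0) (ger0_norm (powR_ge0 _ _)).
rewrite ler_pM ?qC// ger0_norm ?weight1V_le// divr_ge0 ?weight_ge0// subr_ge0.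
by case/andP: x01.
Qed.

(** The integral of the derivative of x q w, which vanishes at both ends. Writing x / (1 - x) = 1 /
    (1 - x) - 1 turns the coefficient a of L q into a + b. *)
Lemma wint_parts t q : 0 < t ->
  wint a b t (('X * q)^`()) + t * wintV a b t q + (a + b) * wint a b t q
    - b * wint1V a b t q = 0.
Proof.
move=> t0; pose w x := weight a b x t.
pose F x := ('X * q).[x] * w x.
pose f x := ('X * q)^`().[x] * w x + t * (q.[x] * w x / x) + (a + b) * (q.[x] * w x)
  - b * (q.[x] * w x / (1 - x)).
have dF x : 0 < x < 1 -> is_derive x 1 F (f x).
  move=> x01; have dw := is_derive_weight_x t x01.
  apply: is_derive_eq (is_deriveM (is_derive_poly ('X * q) x) dw) _.
  rewrite /f /w /GRing.scale/= hornerM hornerX; move: (weight a b x t) => y.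
  have /andP[x0 x1] := x01.
  by field; rewrite !gt_eqF ?subr_gt0.
have I1 := integrable_weight ('X * q)^`() a0 b0 t0.
have I2 := integrable_weightV q a0 b0 t0.
have I3 := integrable_weight q a0 b0 t0.
have I4 := integrable_weight1V q t0.
have intZ (k : R) (g : R -> R) : mu.-integrable `[0, 1] (EFin \o g) ->
    mu.-integrable `[0, 1] (EFin \o (fun x => k * g x)).
  by move=> ig; apply: eq_integrable (integrableZl _ k ig).
have intD (g h : R -> R) : mu.-integrable `[0, 1] (EFin \o g) ->
    mu.-integrable `[0, 1] (EFin \o h) ->
    mu.-integrable `[0, 1] (EFin \o (fun x => g x + h x)).
  by move=> ig ih; apply: eq_integrable (integrableD _ ig ih).
have intB (g h : R -> R) : mu.-integrable `[0, 1] (EFin \o g) ->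
    mu.-integrable `[0, 1] (EFin \o h) ->
    mu.-integrable `[0, 1] (EFin \o (fun x => g x - h x)).
  by move=> ig ih; apply: eq_integrable (integrableB _ ig ih).
have intf : mu.-integrable `[0, 1] (EFin \o f).
  by apply: (intB _ _); [apply: (intD _ _); [apply: (intD _ _)|]|]; rewrite ?intZ.
transitivity (\int[mu]_(x in `[0, 1]) f x).
  rewrite /f RintegralB//;
    [|by apply: (intD _ _); [apply: (intD _ _)|]; rewrite ?intZ|exact: intZ].
  rewrite RintegralD//; [|by apply: (intD _ _); rewrite ?intZ|exact: intZ].
  rewrite RintegralD//; [|exact: intZ].
  by rewrite !RintegralZl.
have cf : {in `]0, 1[, continuous f}.
  move=> x; rewrite in_itv/= => x01; have /andP[x0 x1] := x01.
  have cw : {for x, continuous w}.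
    apply/differentiable_continuous/derivable1_diffP.
    by have := is_derive_weight_x t x01 => ?; apply: ex_derive.
  have ch (p : {poly R}) : {for x, continuous (fun y => p.[y] * w y)}.
    by apply: continuousM => //; exact: continuous_horner.
  have cV : {for x, continuous (fun y : R => y^-1)}.
    by apply: inv_continuous; rewrite gt_eqF.
  have c1V : {for x, continuous (fun y : R => (1 - y)^-1)}.
    apply: continuousV; first by rewrite gt_eqF// subr_gt0.
    by apply: continuousB; [exact: cvg_cst|exact: cvg_id].
  rewrite /prop_for /continuous_at /f.
  apply: cvgB; last by apply: cvgMr; apply: cvgM; [exact: ch|exact: c1V].
  apply: cvgD; last by apply: cvgMr; exact: ch.
  apply: cvgD; first exact: ch.
  by apply: cvgMr; apply: cvgM; [exact: ch|exact: cV].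
have F0 : F 0 = 0 by rewrite /F hornerM hornerX !mul0r.
have F1 : F 1 = 0 by rewrite /F /w /weight subrr powR0 ?gt_eqF// !mulr0.
have cF : {within `[0, 1], continuous F}.
  have [C C0 qC] := horner01_bound q.
  (* The first bound gives continuity of F at 0, the second at 1. *)
  have Fle x : 0 <= x <= 1 -> `|F x| <= C * x /\ `|F x| <= C * (1 - x) `^ b.
    move=> x01; have /andP[x0 x1] := x01.
    have wx1 : w x <= (1 - x) `^ b.
      rewrite /w /weight ler_piMl ?powR_ge0// mulr_ile1 ?expR_ge0 ?powR_ge0 ?powR_le1//.
      by rewrite -expR0 ler_expR mulNr oppr_le0 divr_ge0// ltW.
    rewrite /F hornerM hornerX -mulrA normrM (ger0_norm x0) normrM.
    rewrite (ger0_norm (weight_ge0 _ _ _ _)); split.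
      rewrite mulrC ler_wpM2r// -[leRHS]mulr1 ler_pM ?weight_ge0 ?qC//.
      by rewrite weight_le1// ltW.
    apply: (@le_trans _ _ (1 * (`|q.[x]| * w x))).
      by rewrite ler_wpM2r// mulr_ge0// weight_ge0.
    by rewrite mul1r ler_pM ?weight_ge0 ?qC.
  (* The divisor is C + 1 because C may be 0. *)
  have C1 : 0 < C + 1 by rewrite ltr_wpDl.
  have small e y : 0 < e -> 0 <= y -> y <= e / (C + 1) -> C * y <= e.
    move=> e0 y0; rewrite ler_pdivlMr// => ye.
    by apply: le_trans ye; rewrite mulrC ler_wpM2l// lerDl.
  apply/(continuous_within_itvP _ ltr01); split.
  - move=> x; rewrite in_itv/= => /dF ?.
    by apply/differentiable_continuous/derivable1_diffP; apply: ex_derive.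
  - rewrite F0; apply/cvgrPdist_le => e e0; near=> x.
    have x0 : 0 <= x by near: x; exact: nbhs_right_ge.
    have x1 : x <= 1 by near: x; exact: nbhs_right_le.
    rewrite sub0r normrN; have [|+ _] := Fle x; first by rewrite x0 x1.
    move=> /le_trans; apply; apply: small => //.
    by near: x; apply: nbhs_right_le; rewrite divr_gt0.
  - rewrite F1; apply/cvgrPdist_le => e e0; near=> x.
    have eC0 : 0 < e / (C + 1) by rewrite divr_gt0.
    have x0 : 0 <= x by near: x; exact: nbhs_left_ge.
    have x1 : x <= 1 by near: x; exact: nbhs_left_le.
    rewrite sub0r normrN; have [|_ ] := Fle x; first by rewrite x0 x1.
    move=> /le_trans; apply; apply: small; rewrite ?powR_ge0//.
    (* The radius around 1 is (e / (C + 1))^(1 / b), the preimage of e / (C + 1) under the power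
       b. *)
    have <- : (e / (C + 1)) `^ b^-1 `^ b = e / (C + 1).
      by rewrite -powRrM mulVf ?gt_eqF// powRr1// ltW.
    apply: ge0_ler_powR; rewrite ?nnegrE ?powR_ge0 ?subr_ge0 ?(ltW b0)//.
    rewrite lerBlDr -lerBlDl; near: x; apply: nbhs_left_ge.
    by rewrite ltrBlDr ltrDl powR_gt0// divr_gt0.
rewrite (FTC2_integrable ltr01 intf cf _ cF).
  by rewrite F0 F1 subrr.
by move=> x; rewrite in_itv/=; exact: dF.
Unshelve. all: by end_near. Qed.
End IntegrationByParts.

(** * Orthogonal polynomials of a linear functional *)

Lemma poly_sum_coef (R : nzRingType) (q : {poly R}) N : (size q <= N)%N ->
  q = \sum_(i < N) q`_i *: 'X^i.
Proof.
move=> sq; rewrite -poly_def; apply/polyP => j; rewrite coef_poly.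
by case: ltnP => // nj; rewrite nth_default// (leq_trans sq).
Qed.

Lemma size_sub_monic (R : nzRingType) (p q : {poly R}) n :
  p \is monic -> size p = n.+1 -> (size q <= n.+1)%N ->
  (size (q - q`_n *: p)%R <= n)%N.
Proof.
move=> pm sp sq; apply/leq_sizeP => j; rewrite leq_eqVlt => /predU1P[<-|nj].
  have := monicP pm; rewrite /lead_coef sp/= => p1.
  by rewrite coefB coefZ p1 mulr1 subrr.
by rewrite coefB coefZ [p`_j]nth_default ?sp// mulr0 subr0 nth_default// (leq_trans sq).
Qed.

Lemma size_derivX (R : nzRingType) (p : {poly R}) n :
  (size p <= n.+1)%N -> (size ('X * p^`())%R <= n.+1)%N.
Proof.
move=> sp; apply: leq_trans (size_polyMleq _ _) _; rewrite size_polyX add2n/=.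
apply: leq_trans (_ : (size p).-1.+1 <= _)%N; last by case: (size p) sp.
by rewrite ltnS; exact: size_poly.
Qed.

(** The counterpart of [monic_orthogonal] for an abstract functional; the algebra that follows uses
    no integral. *)
Definition orthogonal_system (R : realFieldType) (L : {poly R} -> R)
    (P : nat -> {poly R}) (h : nat -> R) : Prop :=
  (forall n, P n \is monic /\ size (P n) = n.+1) /\
  (forall m n, L (P m * P n) = h n * (m == n)%:R).

(** The coefficient p_n, with p_0 = 0 so that the telescoping sum starts correctly. *)
Definition subleading (R : realFieldType) (P : nat -> {poly R}) (n : nat) : R :=
  if n is k.+1 then (P n)`_k else 0.

Section OrthogonalPolynomials.
Context (R : realFieldType) (L : {poly R} -> R) (hL : scalar L).
Implicit Types (P : nat -> {poly R}) (h : nat -> R) (p q : {poly R}).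

Lemma scalar_fun0 : L 0 = 0.
Proof.
have := hL 1 0 0; rewrite scaler0 addr0 mul1r => /esym/eqP.
by rewrite -subr_eq0 addrK => /eqP.
Qed.

Lemma scalar_funD p q : L (p + q) = L p + L q.
Proof. by have := hL 1 p q; rewrite scale1r mul1r. Qed.

Lemma scalar_funZ k p : L (k *: p) = k * L p.
Proof. by have := hL k p 0; rewrite !addr0 scalar_fun0 addr0. Qed.

Lemma scalar_funB p q : L (p - q) = L p - L q.
Proof. by rewrite scalar_funD -scaleN1r scalar_funZ mulN1r. Qed.

Context (P : nat -> {poly R}) (h : nat -> R) (oP : orthogonal_system L P h).

(** Induction on the degree bound: the top coefficient of q is removed by a multiple of P_k with k <
    n, which is orthogonal to P_n. *)
Lemma orth_lt n q : (size q <= n)%N -> L (P n * q) = 0.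
Proof.
have [mP oPP] := oP.
suff H k : (k <= n)%N -> (size q <= k)%N -> L (P n * q) = 0 by exact: H.
elim: k q => [|k IHk] q kn.
  by rewrite leqn0 size_poly_eq0 => /eqP->; rewrite mulr0 scalar_fun0.
move=> sq; have [Pm sP] := mP k.
have -> : q = q`_k *: P k + (q - q`_k *: P k) by rewrite addrC subrK.
rewrite mulrDr scalar_funD -scalerAr scalar_funZ oPP gtn_eqF// !mulr0 add0r.
by apply: IHk; [exact: ltnW|exact: size_sub_monic].
Qed.

Lemma orth_coef n q : (size q <= n.+1)%N -> L (P n * q) = q`_n * h n.
Proof.
have [mP oPP] := oP; have [Pm sP] := mP n => sq.
have -> : q = q`_n *: P n + (q - q`_n *: P n) by rewrite addrC subrK.
rewrite mulrDr scalar_funD -scalerAr scalar_funZ oPP eqxx mulr1.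
rewrite orth_lt ?addr0; last exact: size_sub_monic.
rewrite coefD coefZ coefB coefZ; have := monicP Pm; rewrite /lead_coef sP/= => ->.
by rewrite mulr1 subrr addr0.
Qed.

Lemma orth_size n : size (P n) = n.+1. Proof. by have [/(_ n)[]] := oP. Qed.

Lemma orth_lead n : (P n)`_n = 1.
Proof. by have [/(_ n)[/monicP + sP] _] := oP; rewrite /lead_coef sP. Qed.

Lemma orth_norm n : L (P n * P n) = h n.
Proof. by have [_ ->] := oP; rewrite eqxx mulr1. Qed.

Lemma orth_succ n : L (P n * P n.+1) = 0.
Proof. by have [_ ->] := oP; rewrite ltn_eqF// mulr0. Qed.

(** Subtracting the multiple of P_(n+1) that cancels degree n + 1 does not change the value and
    leaves a polynomial to which [orth_coef] applies. *)
Lemma orth_coefS n q : (size q <= n.+2)%N ->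
  L (P n * q) = (q`_n - q`_n.+1 * subleading P n.+1) * h n.
Proof.
move=> sq; have qE : q = q`_n.+1 *: P n.+1 + (q - q`_n.+1 *: P n.+1).
  by rewrite addrC subrK.
rewrite [in LHS]qE mulrDr scalar_funD -scalerAr scalar_funZ orth_succ mulr0 add0r.
rewrite orth_coef; last first.
  by apply: size_sub_monic => //; have [/(_ n.+1)[]] := oP.
by rewrite coefB coefZ.
Qed.

(** The polynomial x P_n has coefficients 1 and p_n in degrees n + 1 and n; the difference p_n -
    p_(n+1) is the diagonal recurrence coefficient. *)
Lemma orth_X n :
  L (P n * ('X * P n)) = (subleading P n - subleading P n.+1) * h n.
Proof.
rewrite orth_coefS; last first.
  by rewrite size_monicM ?monicX ?size_polyX ?orth_size ?addSn// -size_poly_eq0 orth_size.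
rewrite !coefXM /= orth_lead mul1r; congr ((_ - _) * _).
by rewrite /subleading; case: n.
Qed.

(** In degrees n + 1 and n the polynomial x (1 - x) P_n' has coefficients - n and n - (n - 1)
    p_n. *)
Lemma orth_deriv n :
  L (P n * ('X * (1 - 'X) * (P n)^`())) =
  (n%:R - (n%:R - 1) * subleading P n + n%:R * subleading P n.+1) * h n.
Proof.
have -> : 'X * (1 - 'X) * (P n)^`() = 'X * (P n)^`() - 'X * ('X * (P n)^`()) by ring.
have s1 := size_derivX (eq_leq (orth_size n)).
rewrite orth_coefS; last first.
  rewrite (leq_trans (size_polyD _ _))// geq_max (leq_trans s1)// size_polyN.
  apply: leq_trans (size_polyMleq _ _) _; rewrite size_polyX add2n/=.
  by rewrite ltnS.
have cX k : ('X * (P n)^`())`_k = (P n)`_k *+ k.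
  by rewrite coefXM; case: k => [|k]; rewrite ?mulr0n//= coef_deriv.
rewrite !coefB !(coefXM _ n.+1)/= !cX orth_lead coef_deriv.
rewrite [(P n)`_n.+1]nth_default ?orth_size// mul0rn sub0r.
congr (_ * _).
(* At n = 0 the coefficient p_0 is a convention, and the term with n - 1 is checked separately. *)
rewrite coefXM; case: n s1 cX => [|n] s1 cX /=.
  by rewrite !mulr0n; ring.
by rewrite cX /subleading -[n.+1%:R]natr1 -mulr_natr; ring.
Qed.

End OrthogonalPolynomials.

(** * Uniqueness, telescoping and the Hankel determinant *)

Section OrthogonalIdentities.
Context (R : realFieldType) (L : {poly R} -> R) (hL : scalar L).
Context (L_gt0 : forall q, q != 0 -> 0 < L (q * q)).
Context (P : nat -> {poly R}) (h : nat -> R) (oP : orthogonal_system L P h).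

Lemma orth_norm_gt0 n : 0 < h n.
Proof. by rewrite -(orth_norm oP) L_gt0// -size_poly_eq0 (orth_size oP). Qed.

(** Q_n - P_n has degree < n, so it is orthogonal to both Q_n and P_n, hence to itself; positivity
    makes it 0. *)
Lemma orth_unique (Q : nat -> {poly R}) (g : nat -> R) :
  orthogonal_system L Q g -> Q =1 P.
Proof.
move=> oQ n; apply/eqP; rewrite -subr_eq0; apply/negPn/negP => /L_gt0.
have sPQ : (size (Q n - P n)%R <= n)%N.
  have [/(_ n)[Pm sP] _] := oP.
  by rewrite -[P n]scale1r -(orth_lead oQ n) size_sub_monic// (orth_size oQ).
by rewrite mulrBl (scalar_funB hL) (orth_lt hL oP)// (orth_lt hL oQ)// subrr ltxx.
Qed.

(** The hypothesis at q = P_j^2 gives t M (P_j^2) / h_j = t - (2j + 1 + a) + c_j p_j - c_(j+1)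
    p_(j+1) with c_j = 2j + a + b, and this telescopes. *)
Lemma sum_orth_norm_inv (M : {poly R} -> R) (a b t : R) :
  (forall q, L ('X * (1 - 'X) * q)^`() + t * M q + (a - t) * L q
     - (a + b) * L ('X * q) = 0) ->
  forall n, t * \sum_(j < n) M (P j * P j) / h j =
    n%:R * t - n%:R * (n%:R + a) - (2 * n%:R + a + b) * subleading P n.
Proof.
move=> ibp; elim=> [|n IHn]; first by rewrite big_ord0 /subleading; ring.
rewrite big_ord_recr/= mulrDr IHn.
have h_neq0 : h n != 0 by rewrite gt_eqF// orth_norm_gt0.
have := ibp (P n * P n).
have -> : ('X * (1 - 'X) * (P n * P n))^`() =
    P n * P n - 2%:R *: (P n * ('X * P n)) + 2%:R *: (P n * ('X * (1 - 'X) * (P n)^`())).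
  rewrite !derivM derivB derivX -polyC1 derivC -!mul_polyC polyCMn.
  by rewrite polyC1; ring.
rewrite (scalar_funD hL) (scalar_funB hL) !(scalar_funZ hL).
rewrite ['X * (P n * P n)]mulrCA.
rewrite (orth_norm oP) (orth_X hL oP) (orth_deriv hL oP) => H.
have -> : t * (M (P n * P n) / h n) = (t * M (P n * P n)) / h n by rewrite mulrA.
apply: (mulIf h_neq0); rewrite mulrDl divfK// -[n.+1%:R]natr1.
rewrite -[(P n.+1)`_n]/(subleading P n.+1).
by apply: subr0_eq; rewrite -[RHS]H; ring.
Qed.

(** The hypothesis at q = P_k P_(k+1). Orthogonality kills L q and the term with P_k'; the term with
    P_(k+1)' contributes (k - (k + 1)) p_(k+1) h_k. *)
Lemma orth_parts_succ (M N : {poly R} -> R) (a b t : R) :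
  (forall q, L ('X * q)^`() + t * M q + (a + b) * L q - b * N q = 0) ->
  forall k, t * M (P k * P k.+1) - b * N (P k * P k.+1) = subleading P k.+1 * h k.
Proof.
move=> parts k; have := parts (P k * P k.+1).
have -> : ('X * (P k * P k.+1))^`() =
    P k * P k.+1 + P k.+1 * ('X * (P k)^`()) + P k * ('X * (P k.+1)^`()).
  by rewrite !derivM derivX; ring.
rewrite !(scalar_funD hL) (orth_succ oP) (orth_lt hL oP); last first.
  by apply: size_derivX; rewrite (orth_size oP).
rewrite (orth_coefS hL oP); last by apply: size_derivX; rewrite (orth_size oP).
have -> : ('X * (P k.+1)^`())`_k = k%:R * subleading P k.+1.
  rewrite coefXM /subleading; case: k => [|k]; first by rewrite mul0r.
  by rewrite /= coef_deriv mulr_natl.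
rewrite coefXM /= coef_deriv (orth_lead oP) mulrSr => H.
by apply: subr0_eq; rewrite -[RHS]H; ring.
Qed.

(** The coefficient matrix C of P_0, ..., P_(n-1) is unitriangular, and C A C^T is the Gram matrix,
    which is diagonal with entries h_j. *)
Lemma hankel_orth_norm n :
  \det (\matrix_(i < n, j < n) L ('X^(i + j))) = \prod_(j < n) h j.
Proof.
pose A := \matrix_(i < n, j < n) L ('X^(i + j)).
pose C := \matrix_(i < n, j < n) (P i)`_j.
have PE (i : 'I_n) : P i = \sum_(j < n) (P i)`_j *: 'X^j.
  by apply: poly_sum_coef; rewrite (orth_size oP).
have detC : \det C = 1.
  rewrite det_trig.
    by rewrite big1// => i _; rewrite mxE (orth_lead oP).
  by apply/is_trig_mxP => i j ij; rewrite mxE nth_default// (orth_size oP).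
have Lsum (I : Type) (s : seq I) (F : I -> {poly R}) :
    L (\sum_(i <- s) F i) = \sum_(i <- s) L (F i).
  by apply: big_morph; [exact: (scalar_funD hL)|exact: (scalar_fun0 hL)].
have CAC : C *m A *m C^T = diag_mx (\row_(j < n) h j).
  apply/matrixP => i k; rewrite !mxE.
  transitivity (L (P i * P k)); last first.
    by have [_ ->] := oP; rewrite mulr_natr -val_eqE/=; case: eqVneq => [->|].
  rewrite [in RHS](PE i) [in RHS](PE k) mulr_sumr Lsum; apply: eq_bigr => l _.
  rewrite mulr_suml Lsum !mxE mulr_suml; apply: eq_bigr => j _.
  have -> : (P i)`_j *: 'X^j * ((P k)`_l *: 'X^l) =
      ((P i)`_j * (P k)`_l) *: 'X^(j + l).
    by rewrite exprD -scalerAl -scalerAr scalerA.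
  by rewrite (scalar_funZ hL) !mxE mulrAC.
have := congr1 determinant CAC.
rewrite !det_mulmx det_tr detC mul1r mulr1 det_diag => ->.
by apply: eq_bigr => j _; rewrite mxE.
Qed.

End OrthogonalIdentities.

(** * The three-term recurrence *)

(* The pair is (V_(n-1), V_n), with V_(-1) = 0; at n = 1 the coefficient of V_(-1)
   is a division by L 0 = 0. *)
Fixpoint orth_rec (R : realFieldType) (L : {poly R} -> R) (n : nat) :
    {poly R} * {poly R} :=
  if n is k.+1 then
    let: (p, q) := orth_rec L k in
    (q, ('X - (L ('X * (q * q)) / L (q * q))%:P) * q - (L (q * q) / L (p * p)) *: p)
  else (0, 1).

(** The given family is orthogonal at one parameter value only; differentiation in the parameter
    needs a family for all values, built here from L by explicit formulas. *)
Definition orth_poly (R : realFieldType) (L : {poly R} -> R) (n : nat) : {poly R} :=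
  (orth_rec L n).2.

(** The V_(n-1) term of the recurrence, split off so that the recurrence has one form for all n,
    including n = 0. *)
Definition orth_prev (R : realFieldType) (L : {poly R} -> R) (n : nat) : {poly R} :=
  if n is k.+1 then
    (L (orth_poly L n * orth_poly L n) / L (orth_poly L k * orth_poly L k))
      *: orth_poly L k
  else 0.

Section Recurrence.
Context (R : realFieldType) (L : {poly R} -> R).
Notation V := (orth_poly L).
Notation a n := (L ('X * (V n * V n)) / L (V n * V n)).

Lemma orth_polyS n : V n.+1 = ('X - (a n)%:P) * V n - orth_prev L n.
Proof.
rewrite /orth_poly /=; case: n => [|n] /=; first by rewrite scaler0.
by rewrite /orth_prev /orth_poly /=; case: (orth_rec L n).
Qed.

Lemma orth_poly_monic n : V n \is monic /\ size (V n) = n.+1.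
Proof.
suff: (V n \is monic /\ size (V n) = n.+1) /\ (size (orth_prev L n) <= n)%N by case.
elim: n => [|n [[mV sV] sp]]; first by rewrite monic1 size_poly1 size_poly0.
split; last by rewrite /= (leq_trans (size_scale_leq _ _))// sV.
have sXV : size (('X - (a n)%:P) * V n) = n.+2.
  by rewrite size_monicM ?monicXsubC -?size_poly_eq0 ?sV// size_XsubC.
have lt : (size (- orth_prev L n)%R < size (('X - (a n)%:P) * V n)%R)%N.
  by rewrite size_polyN sXV ltnS (leq_trans sp).
rewrite orth_polyS size_polyDl// sXV; split => //.
by rewrite monicE lead_coefDl// lead_coefM lead_coefXsubC mul1r -monicE.
Qed.

Lemma orth_poly_lead n : (V n)`_n = 1.
Proof. by have [/monicP + sV] := orth_poly_monic n; rewrite /lead_coef sV. Qed.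

Lemma orth_poly_neq0 n : V n != 0.
Proof. by rewrite -size_poly_eq0 (orth_poly_monic n).2. Qed.

Context (hL : scalar L) (L_gt0 : forall q, q != 0 -> 0 < L (q * q)).

(** Strong induction on n. The factor x is moved from V_n to V_m and x V_m is expanded by the
    recurrence; the surviving terms cancel by the choice of the two recurrence coefficients. *)
Lemma orth_poly_lt n m : (m < n)%N -> L (V n * V m) = 0.
Proof.
have h0 k : L (V k * V k) != 0 by rewrite gt_eqF// L_gt0// orth_poly_neq0.
elim/ltn_ind: n m => -[|n] IHn m; first by rewrite ltn0.
rewrite ltnS => mn.
have IH i j : (i <= n)%N -> (j < i)%N -> L (V i * V j) = 0.
  move=> i_n; exact: (IHn i (leq_ltn_trans i_n (ltnSn n))).
have prev0 i j : (j <= n)%N -> (i <= j)%N -> L (V j * orth_prev L i) = 0.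
  move=> jn; case: i => [|i] ij /=; first by rewrite mulr0 (scalar_fun0 hL).
  by rewrite -scalerAr (scalar_funZ hL) (IH j i)// mulr0.
have -> : V n.+1 * V m = V n * ('X * V m) - a n *: (V n * V m) - V m * orth_prev L n.
  by rewrite orth_polyS -mul_polyC; ring.
rewrite (scalar_funB hL) (scalar_funB hL) (scalar_funZ hL).
(* For m = n the diagonal coefficient gives the cancellation. *)
move: mn; rewrite leq_eqVlt => /predU1P[->|mn].
  by rewrite prev0// mulrCA divfK// subrr subr0.
rewrite (IH n m)// mulr0 subr0.
have -> : 'X * V m = V m.+1 + a m *: V m + orth_prev L m.
  by rewrite orth_polyS -mul_polyC; ring.
rewrite !mulrDr !(scalar_funD hL) -scalerAr (scalar_funZ hL) (IH n m)// mulr0 addr0.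
rewrite (prev0 m n)//; last exact: ltnW.
case: n mn IHn IH prev0 => // n mn IHn IH prev0 /=.
rewrite addr0 -scalerAr (scalar_funZ hL).
(* For m one below the top index, the ratio of norms in [orth_prev] gives the cancellation; for
   smaller m both terms vanish. *)
move: mn; rewrite ltnS leq_eqVlt => /predU1P[->|mn].
  by rewrite divfK// subrr.
rewrite [V m * V n]mulrC (IH n m)// mulr0 subr0.
by apply: IH.
Qed.

Lemma orth_poly_system : orthogonal_system L V (fun n => L (V n * V n)).
Proof.
split=> [n|m n]; first exact: orth_poly_monic.
have [mn|nm|->] := ltngtP m n; rewrite ?mulr1 ?mulr0 //.
  by rewrite mulrC orth_poly_lt.
  exact: orth_poly_lt.
Qed.

End Recurrence.

(** * Dependence on the parameter *)

Section PolynomialCurves.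
Context (R : realType).
Implicit Types (Q S : R -> {poly R}) (s : R).

(** Differentiability is coefficientwise, with a degree bound common to all parameters, so that a
    functional applied to the curve is a fixed finite sum of coefficients times moments. *)
Definition is_derive_poly_curve s Q (dQ : {poly R}) : Prop :=
  exists2 N, forall u, (size (Q u) <= N)%N
  & (size dQ <= N)%N /\ forall i, is_derive s 1 (fun u => (Q u)`_i) dQ`_i.

Lemma is_derive_curve_cst s (p : {poly R}) : is_derive_poly_curve s (fun=> p) 0.
Proof.
exists (size p) => //; split; first by rewrite size_poly0.
by move=> i; rewrite coef0; exact: is_derive_cst.
Qed.

Lemma is_derive_curveC s (c : R -> R) dc : is_derive s 1 c dc ->
  is_derive_poly_curve s (fun u => (c u)%:P) dc%:P.
Proof.
move=> dcs; exists 1%N; first by move=> u; exact: size_polyC_leq1.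
split; first exact: size_polyC_leq1.
move=> i; rewrite coefC; case: i => [|i] /=.
  by under eq_fun do rewrite coefC.
by under eq_fun do rewrite coefC; exact: is_derive_cst.
Qed.

Lemma is_derive_curveB s Q dQ S dS : is_derive_poly_curve s Q dQ ->
  is_derive_poly_curve s S dS ->
  is_derive_poly_curve s (fun u => Q u - S u) (dQ - dS).
Proof.
move=> [N sQ [sdQ dQs]] [K sS [sdS dSs]].
have sB (p q : {poly R}) : (size p <= N)%N -> (size q <= K)%N ->
    (size (p - q)%R <= maxn N K)%N.
  move=> pN qK; rewrite (leq_trans (size_polyD _ _))// size_polyN geq_max.
  by rewrite !leq_max pN qK orbT.
exists (maxn N K) => [u|]; first exact: sB.
split; first exact: sB.
move=> i; rewrite coefB; under eq_fun do rewrite coefB.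
exact: is_deriveB.
Qed.

Lemma is_derive_curveM s Q dQ S dS : is_derive_poly_curve s Q dQ ->
  is_derive_poly_curve s S dS ->
  is_derive_poly_curve s (fun u => Q u * S u) (dQ * S s + Q s * dS).
Proof.
move=> [N sQ [sdQ dQs]] [K sS [sdS dSs]].
have sM (p q : {poly R}) : (size p <= N)%N -> (size q <= K)%N ->
    (size (p * q)%R <= N + K)%N.
  move=> pN qK; rewrite (leq_trans (size_polyMleq _ _))//.
  by rewrite (leq_trans (leq_pred _))// leq_add.
exists (N + K)%N => [u|]; first exact: sM.
split; first by rewrite (leq_trans (size_polyD _ _))// geq_max !sM.
move=> i; rewrite coefD !coefM.
rewrite (_ : (fun u => _) = \sum_(j < i.+1) (fun u => (Q u)`_j * (S u)`_(i - j))).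
  rewrite -big_split /=; apply: is_derive_sum => j.
  apply: is_derive_eq (is_deriveM (dQs j) (dSs (i - j)%N)) _.
  by rewrite /GRing.scale/=; ring.
by rewrite fct_sumE; apply/funext => u; rewrite coefM.
Qed.

Context (L M : R -> {poly R} -> R).
Context (hL : forall s, 0 < s -> scalar (L s)).
Context (hM : forall s, 0 < s -> scalar (M s)).
Context (dL : forall s q, 0 < s -> is_derive s 1 (fun u => L u q) (- M s q)).

Lemma scalar_fun_coef (F : {poly R} -> R) N (q : {poly R}) :
  scalar F -> (size q <= N)%N ->
  F q = \sum_(i < N) q`_i * F 'X^i.
Proof.
move=> hF sq; rewrite [in LHS](poly_sum_coef sq).
rewrite (big_morph _ (scalar_funD hF) (scalar_fun0 hF)).
by apply: eq_bigr => i _; rewrite scalar_funZ.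
Qed.

(** Near s the value is a finite sum of coefficients times moments; the product rule gives one term
    from the coefficients and one from the moments, the latter with the sign of [dL]. *)
Lemma is_derive_scalar_fun s Q dQ : 0 < s -> is_derive_poly_curve s Q dQ ->
  is_derive s 1 (fun u => L u (Q u)) (L s dQ - M s (Q s)).
Proof.
move=> s0 [N sQ [sdQ dQs]].
apply: (@near_eq_is_derive _ _ _ (\sum_(i < N) (fun u => (Q u)`_i * L u 'X^i))).
  near=> u; rewrite fct_sumE [RHS](@scalar_fun_coef _ N)//.
  by apply: hL; near: u; exact: lt_nbhsr.
rewrite (scalar_fun_coef (hL s0) sdQ) (scalar_fun_coef (hM s0) (sQ s)).
rewrite -sumrB; apply: is_derive_sum => i.
apply: is_derive_eq (is_deriveM (dQs i) (dL 'X^i s0)) _.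
by rewrite /GRing.scale/=; ring.
Unshelve. all: by end_near. Qed.

Context (L_gt0 : forall s q, 0 < s -> q != 0 -> 0 < L s (q * q)).
Notation V u n := (orth_poly (L u) n).

Lemma is_derive_curveV n s : 0 < s ->
  exists dV, is_derive_poly_curve s (fun u => V u n) dV.
Proof.
move=> s0.
(* The induction carries the V_(n-1) term along; the quotients in the recurrence are derivable since
   the norms are nonzero at s. *)
suff: (exists dV, is_derive_poly_curve s (fun u => V u n) dV) /\
      (exists dW, is_derive_poly_curve s (fun u => orth_prev (L u) n) dW) by case.
have Lx Q dQ : is_derive_poly_curve s Q dQ -> derivable (fun u => L u (Q u)) s 1.
  by move=> /(is_derive_scalar_fun s0) ?; apply: ex_derive.
have h0 k : L s (V s k * V s k) != 0.
  by rewrite gt_eqF// L_gt0// orth_poly_neq0.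
have Cx (c : R -> R) : derivable c s 1 ->
    is_derive_poly_curve s (fun u => (c u)%:P) ('D_1 c s)%:P.
  by move=> /derivableP; exact: is_derive_curveC.
elim: n => [|n [[dV hV] [dW hW]]].
  by split; exists 0; exact: is_derive_curve_cst.
have hVV := is_derive_curveM hV hV.
have hXVV := is_derive_curveM (is_derive_curve_cst s 'X) hVV.
have [dV' hV'] : exists dV, is_derive_poly_curve s (fun u => V u n.+1) dV.
  have ca : derivable (fun u => L u ('X * (V u n * V u n)) / L u (V u n * V u n)) s 1.
    apply: derivableM; first exact: Lx hXVV.
    by apply: derivableV; [exact: h0|exact: Lx hVV].
  have := is_derive_curveB (is_derive_curveM
    (is_derive_curveB (is_derive_curve_cst s 'X) (Cx _ ca)) hV) hW.
  set d := (X in is_derive_poly_curve _ _ X) => hd; exists d.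
  by under eq_fun do rewrite orth_polyS.
split; first by exists dV'.
have hVV' := is_derive_curveM hV' hV'.
have cb : derivable (fun u => L u (V u n.+1 * V u n.+1) / L u (V u n * V u n)) s 1.
  apply: derivableM; first exact: Lx hVV'.
  by apply: derivableV; [exact: h0|exact: Lx hVV].
have := is_derive_curveM (Cx _ cb) hV.
set d := (X in is_derive_poly_curve _ _ X) => hd; exists d.
by under eq_fun do rewrite /= -mul_polyC.
Qed.

(** From degree n on, the coefficients of V_n are constant in the parameter: 1 in degree n, 0
    above. *)
Lemma coef_orth_derive n s dV i : is_derive_poly_curve s (fun u => V u n) dV ->
  (n <= i)%N -> dV`_i = 0.
Proof.
move=> [_ _ [_ /(_ i) dVi]] ni; have [_ <-] := dVi.
rewrite (_ : (fun u => _) = cst (V s n)`_i) ?derive_cst//.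
apply/funext => u /=; move: ni; rewrite leq_eqVlt => /predU1P[<-|ni].
  by rewrite !orth_poly_lead.
by rewrite !nth_default// (orth_poly_monic _ _).2.
Qed.

Lemma size_orth_derive n s dV : is_derive_poly_curve s (fun u => V u n) dV ->
  (size dV <= n)%N.
Proof. by move=> hV; apply/leq_sizeP => i; exact: coef_orth_derive hV. Qed.

Lemma is_derive_orth_norm n s : 0 < s ->
  is_derive s 1 (fun u => L u (V u n * V u n)) (- M s (V s n * V s n)).
Proof.
move=> s0; have [dV hV] := is_derive_curveV n s0.
apply: is_derive_eq (is_derive_scalar_fun s0 (is_derive_curveM hV hV)) _.
have sys := orth_poly_system (hL s0) (fun q => @L_gt0 s q s0).
have dV0 := orth_lt (hL s0) sys (size_orth_derive hV).
by rewrite (scalar_funD (hL s0)) [dV * _]mulrC dV0 addr0 sub0r.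
Qed.

(** In the derivative of L (V_n V_(n+1)) = 0 the term with V_n' vanishes by degree, and L (V_n
    V_(n+1)') = p_(n+1)' h_n because V_(n+1)' has degree at most n. *)
Lemma is_derive_subleading n s : 0 < s ->
  is_derive s 1 (fun u => subleading (orth_poly (L u)) n.+1)
    (M s (V s n * V s n.+1) / L s (V s n * V s n)).
Proof.
move=> s0; have [dV hV] := is_derive_curveV n s0.
have [dW hW] := is_derive_curveV n.+1 s0.
have sys u (u0 : 0 < u) := orth_poly_system (hL u0) (fun q => @L_gt0 u q u0).
have D := is_derive_scalar_fun s0 (is_derive_curveM hV hW).
have D0 : is_derive s 1 (fun u => L u (V u n * V u n.+1)) 0.
  apply: (@near_eq_is_derive _ _ _ (cst (0 : R))).
  near=> u; rewrite /= (orth_succ (sys u _))//.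
  by near: u; exact: lt_nbhsr.
have [_ E1] := D; have [_ E2] := D0.
move: E1; rewrite E2 => /esym/eqP; rewrite subr_eq0 => /eqP E.
have [_ _ [_ dWs]] := hW; apply: is_derive_eq (dWs n) _.
rewrite -E (scalar_funD (hL s0)) [dV * _]mulrC.
rewrite (orth_lt (hL s0) (sys s s0) (leqW (size_orth_derive hV))) add0r.
rewrite (orth_coef (hL s0) (sys s s0) (size_orth_derive hW)).
by rewrite mulfK// gt_eqF// L_gt0// orth_poly_neq0.
Unshelve. all: by end_near. Qed.

End PolynomialCurves.

(** * Auxiliary quantities of the Pollaczek-Jacobi weight *)

Section PollaczekJacobi.
Context (R : realType) (a b : R) (a0 : 0 < a) (b0 : 0 < b).
Notation L := (wint a b).
Notation V s := (orth_poly (L s)).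
Notation hV s n := (L s (V s n * V s n)).

Lemma wint_system s : 0 < s -> orthogonal_system (L s) (V s) (fun n => hV s n).
Proof.
move=> s0; apply: orth_poly_system; first exact: wint_scalar.
by move=> q; exact: wint_sqr_gt0.
Qed.

Lemma orth_norm_wint_gt0 s n : 0 < s -> 0 < hV s n.
Proof. by move=> s0; rewrite wint_sqr_gt0// orth_poly_neq0. Qed.

(** Integration by parts for (1 - x) q: the factor 1 - x cancels the denominator, so only L and M
    remain. *)
Lemma wint_parts_onem s q : 0 < s ->
  L s ('X * (1 - 'X) * q)^`() + s * wintV a b s q + (a - s) * L s q
    - (a + b) * L s ('X * q) = 0.
Proof.
move=> s0; have := wint_parts a0 b0 ((1 - 'X) * q) s0.
have -> : wint1V a b s ((1 - 'X) * q) = L s q.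
  apply: eq_Rintegral => x _; rewrite !(hornerM, hornerD, hornerN, hornerC, hornerX).
  (* At x = 1 the quotient is 0 by convention, and the weight vanishes as well. *)
  have [->|x1] := eqVneq x 1.
    have -> : weight a b 1 s = 0 by rewrite /weight subrr powR0 ?gt_eqF// mulr0.
    by rewrite !(mulr0, mul0r).
  by field; rewrite subr_eq0 eq_sym.
have qE : (1 - 'X) * q = q - 'X * q by ring.
rewrite mulrA qE (scalar_funB (wint_scalar a0 b0 s0)).
by rewrite (scalar_funB (wintV_scalar a0 b0 s0)) wintVMX// => <-; ring.
Qed.

Lemma hankel_det_prod s n : 0 < s -> hankel_det a b n s = \prod_(j < n) hV s j.
Proof.
move=> s0; rewrite -(hankel_orth_norm (wint_scalar a0 b0 s0) (wint_system s0)).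
congr (\det _); apply/matrixP => i j; rewrite !mxE.
by apply: eq_Rintegral => x _; rewrite hornerXn.
Qed.

(** A closed form valid for every s > 0, which can therefore be differentiated in s. *)
Lemma H_subleading s n : 0 < s ->
  H_ a b n s = (2 * n%:R + a + b) * subleading (V s) n
    - n%:R * s + n%:R * (n%:R + a).
Proof.
move=> s0; rewrite /H_ derive1E.
have -> : 'D_1 (fun u => ln (hankel_det a b n u)) s =
    - \sum_(j < n) wintV a b s (V s j * V s j) / hV s j.
  apply: derive_val.
  (* The splitting of the logarithm into a sum is established for u > 0, hence near s. *)
  apply: (@near_eq_is_derive _ _ _ (\sum_(j < n) (fun u => ln (hV u j)))).
    near=> u; have u0 : 0 < u by near: u; exact: lt_nbhsr.
    rewrite hankel_det_prod// fct_sumE; elim: n => [|n IHn].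
      by rewrite !big_ord0 ln1.
    rewrite !big_ord_recr/= IHn lnM// posrE ?orth_norm_wint_gt0//.
    by apply: prodr_gt0 => i _; exact: orth_norm_wint_gt0.
  rewrite -sumrN; apply: is_derive_sum => j.
  have h0 := orth_norm_wint_gt0 j s0.
  have dh := is_derive_orth_norm (fun u => @wint_scalar _ _ _ a0 b0 u)
    (fun u => @wintV_scalar _ _ _ a0 b0 u) (fun u q => @is_derive_wint _ _ _ a0 b0 u q)
    (fun u q => @wint_sqr_gt0 _ _ _ a0 b0 u q) j s0.
  apply: is_derive_eq (@is_derive1_comp R (@ln R) _ s _ _ (is_derive1_ln h0) dh) _.
  by rewrite mulrC mulNr.
have := sum_orth_norm_inv (wint_scalar a0 b0 s0)
  (fun q => @wint_sqr_gt0 _ _ _ a0 b0 s q s0) (wint_system s0)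
  (fun q => wint_parts_onem q s0) n.
by rewrite mulrN => ->; ring.
Unshelve. all: by end_near. Qed.

Lemma derive1_H t n : 0 < t -> t * derive1 (H_ a b n.+1) t =
  (2 * n.+1%:R + a + b) * (t * wintV a b t (V t n * V t n.+1) / hV t n) - n.+1%:R * t.
Proof.
move=> t0; rewrite derive1E.
have dS := is_derive_subleading (fun u => @wint_scalar _ _ _ a0 b0 u)
  (fun u => @wintV_scalar _ _ _ a0 b0 u) (fun u q => @is_derive_wint _ _ _ a0 b0 u q)
  (fun u q => @wint_sqr_gt0 _ _ _ a0 b0 u q) n t0.
have dH : is_derive t 1 (H_ a b n.+1)
    ((2 * n.+1%:R + a + b) * (wintV a b t (V t n * V t n.+1) / hV t n) - n.+1%:R).
  apply: (@near_eq_is_derive _ _ _ (fun u => (2 * n.+1%:R + a + b) *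
      subleading (V u) n.+1 - n.+1%:R * u + n.+1%:R * (n.+1%:R + a))).
    near=> u; rewrite H_subleading//.
    by near: u; exact: lt_nbhsr.
  apply: is_derive_eq; rewrite /GRing.scale/=; ring.
have [_ ->] := dH; ring.
Unshelve. all: by end_near. Qed.

End PollaczekJacobi.

(** * From H_n and its derivative to the two auxiliary quantities *)

Theorem lemma5p1 (R : realType) (alpha beta : R)
    (halpha : 0 < alpha) (hbeta : 0 < beta)
    (n : nat) (t : R) (ht : 0 < t)
    (P : nat -> {poly R}) (h : nat -> R)
    (hP : monic_orthogonal alpha beta t P h) :
  rstar alpha beta t P h n
    = (n%:R * t + t * derive1 (H_ alpha beta n) t) / (2 * n%:R + alpha + beta)
  /\
  r_ alpha beta t P h n
    = (n%:R * (n%:R + alpha) + t * derive1 (H_ alpha beta n) t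
         - H_ alpha beta n t)
      / (2 * n%:R + alpha + beta).
Proof.
have c_neq0 (m : nat) : 2 * m%:R + alpha + beta != 0.
  by rewrite gt_eqF// -addrA ltr_wpDl ?mulr_ge0 ?addr_gt0.
(* For n = 0 the empty determinant is 1, so H_0 = 0 and both formulas read 0 = 0. *)
case: n => [|k].
  have H0 : H_ alpha beta 0 = fun=> 0.
    apply/funext => s; rewrite /H_ derive1E.
    rewrite (_ : (fun u => _) = cst 0) ?derive_cst ?mulr0//.
    by apply/funext => u; rewrite /hankel_det det_mx00 ln1.
  by rewrite H0 derive1_cst /= !(mul0r, mulr0, addr0, subr0).
have oP : orthogonal_system (wint alpha beta t) P h.
  have [mP oPP] := hP; split=> // m n; rewrite -oPP.
  by apply: eq_Rintegral => x _; rewrite hornerM.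
(* At the value t the given family coincides with the one built by recurrence, so the formulas for
   the latter transfer. *)
have PV := orth_unique (wint_scalar halpha hbeta ht)
  (fun q => @wint_sqr_gt0 _ _ _ halpha hbeta t q ht) (wint_system halpha hbeta ht) oP.
have hE := orth_norm oP k.
have hk_neq0 : h k != 0.
  by rewrite gt_eqF// -hE PV orth_norm_wint_gt0.
have rsE : rstar alpha beta t P h k.+1 =
    t * wintV alpha beta t (P k * P k.+1) / h k.
  rewrite /rstar mulrAC; congr (_ * _ / _).
  by apply: eq_Rintegral => x _; rewrite hornerM.
have rE : r_ alpha beta t P h k.+1 =
    beta * wint1V alpha beta t (P k * P k.+1) / h k.
  rewrite /r_ mulrAC; congr (_ * _ / _).
  by apply: eq_Rintegral => x _; rewrite hornerM.
have E1 : t * derive1 (H_ alpha beta k.+1) t =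
    (2 * k.+1%:R + alpha + beta) * rstar alpha beta t P h k.+1 - k.+1%:R * t.
  by rewrite derive1_H// rsE -hE !PV.
have E2 : r_ alpha beta t P h k.+1 =
    rstar alpha beta t P h k.+1 - subleading P k.+1.
  have := orth_parts_succ (wint_scalar halpha hbeta ht)  oP
    (fun q => wint_parts halpha hbeta q ht) k.
  by rewrite rE rsE => E; apply: (mulIf hk_neq0); rewrite mulrBl !divfK// -E; ring.
have E3 : H_ alpha beta k.+1 t = (2 * k.+1%:R + alpha + beta) * subleading P k.+1
    - k.+1%:R * t + k.+1%:R * (k.+1%:R + alpha).
  by rewrite H_subleading// /subleading PV.
split; apply: (mulIf (c_neq0 k.+1)); rewrite divfK//.
  by rewrite E1; ring.
(* The terms n t from t H' and from H cancel, which leaves n (n + alpha). *)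
by rewrite E2 E1 E3; ring.
Qed.
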